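(* Let $X$ be a normed linear space over $K$ (where $K=\mathbb{R}$ or $K=\mathbb{C}$). The following are equivalent: 1. $X$ is strictly convex. 2. For each $x\in S_X$ there exists a Hamel basis of $X$ containing $x$ which is strongly orthonormal relative to $x$ in the sense of Birkhoff-James. 3. For each $x\in S_X$ there exists a bounded linear operator $A$ on $X$ which attains its norm only at the points of the form $\lambda x$ with $\lambda\in S_K$.
   Context: $S_X=\{x\in X:\|x\|=1\}$ is the unit sphere and $B_X=\{x\in X:\|x\|\le 1\}$ is the unit ball of $X$; $S_K=\{\lambda\in K:|\lambda|=1\}$. $X$ is strictly convex iff every element of $S_X$ is an extreme point of $B_X$. A finite set $S=\{x_1,\dots,x_n\}\subset X$ (of distinct elements) is strongly orthogonal relative to an element $x_{i_0}\in S$ in the sense of Birkhoff-James iff $\|x_{i_0}\| < \|x_{i_0}+\sum_{j\neq i_0}\lambda_j x_j\|$ for all scalars $\lambda_j\in K$ ($1\le j\le n$, $j\ne i_0$) that are not all $0$. An infinite set is strongly orthogonal relative to an element contained in it iff every finite subset containing that element is strongly orthogonal relative to that element. The set is called strongly orthonormal relative to the element if, in addition, every element of the set has norm $1$. A bounded linear operator $A:X\to X$ attains its norm only at the points of the form $\lambda x$ with $\lambda\in S_K$ if $\{y\in S_X:\|Ay\|=\|A\|\}=\{\lambda x:\lambda\in S_K\}$ (in particular the norm is attained), where $\|A\|$ is the operator norm. *)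

(* Defs.v *)
(* MathComp-Analysis.  For [X : normedModType K] the norm [`|x|] takes values
   in [K] itself.  When [K = R[i]], the order is the partial order in which
   [a <= b] means that [b - a] is a nonnegative real, so norms are nonnegative
   reals, [0 < t < 1] forces [t] to be real, and suprema of nonempty sets of
   nonnegative reals are the usual ones. *)
From HB Require Import structures.
From mathcomp Require Import all_boot all_order all_algebra.
From mathcomp Require Import all_classical all_reals all_analysis.
From mathcomp.real_closed Require Export complex.

Set Implicit Arguments.
Unset Strict Implicit.
Unset Printing Implicit Defensive.

Import Order.TTheory GRing.Theory Num.Theory.
Import numFieldNormedType.Exports.

Local Open Scope classical_set_scope.
Local Open Scope ring_scope.

Definition unit_sphere (K : numFieldType) (X : normedModType K) : set X :=
  [set x | `|x| = 1].

Definition unit_ball (K : numFieldType) (X : normedModType K) : set X :=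
  [set x | `|x| <= 1].

Arguments unit_sphere {K} X.
Arguments unit_ball {K} X.

Definition extreme_point (K : numFieldType) (X : normedModType K)
    (C : set X) (x : X) : Prop :=
  C x /\ forall (y z : X) (t : K), C y -> C z -> 0 < t -> t < 1 ->
    x = t *: y + (1 - t) *: z -> y = x /\ z = x.

Definition strictly_convex (K : numFieldType) (X : normedModType K) : Prop :=
  unit_sphere X `<=` extreme_point (unit_ball X).

Arguments strictly_convex {K} X.

(* The sums [\sum_(y \in F)] below are only used with [F] finite, where they
   are ordinary sums; on an infinite set with infinite support such a sum
   would be [0]. *)

Definition linearly_independent (K : numFieldType) (X : normedModType K)
    (B : set X) : Prop :=
  forall (F : set X) (l : X -> K), finite_set F -> F `<=` B ->
    \sum_(y \in F) l y *: y = 0 -> forall y, F y -> l y = 0.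

Definition spanning (K : numFieldType) (X : normedModType K)
    (B : set X) : Prop :=
  forall v : X, exists (F : set X) (l : X -> K),
    [/\ finite_set F, F `<=` B & v = \sum_(y \in F) l y *: y].

Definition hamel_basis (K : numFieldType) (X : normedModType K)
    (B : set X) : Prop :=
  linearly_independent B /\ spanning B.

Definition finite_strongly_orthogonal (K : numFieldType) (X : normedModType K)
    (F : set X) (x0 : X) : Prop :=
  forall l : X -> K, (exists2 y, (F `\ x0) y & l y != 0) ->
    `|x0| < `|x0 + \sum_(y \in F `\ x0) l y *: y|.

Definition strongly_orthogonal (K : numFieldType) (X : normedModType K)
    (S : set X) (x0 : X) : Prop :=
  [/\ S x0,
      finite_set S -> finite_strongly_orthogonal S x0
    & infinite_set S -> forall F : set X, finite_set F -> F `<=` S -> F x0 ->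
        finite_strongly_orthogonal F x0].

Definition strongly_orthonormal (K : numFieldType) (X : normedModType K)
    (S : set X) (x0 : X) : Prop :=
  strongly_orthogonal S x0 /\ S `<=` unit_sphere X.

Definition bounded_operator (K : numFieldType) (X : normedModType K)
    (A : {linear X -> X}) : Prop :=
  [bounded A y | y in unit_ball X].

(* [supremum] returns its first argument when there is no least upper bound;
   for a bounded operator over [R] or [R[i]] there always is one. *)
Definition operator_norm (K : numFieldType) (X : normedModType K)
    (A : {linear X -> X}) : K :=
  supremum 0 [set `|A y| | y in unit_ball X].

Definition attains_norm_only_at (K : numFieldType) (X : normedModType K)
    (A : {linear X -> X}) (x : X) : Prop :=
  [set y | unit_sphere X y /\ `|A y| = operator_norm A] =
  [set l *: x | l in [set l : K | `|l| = 1]].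

(* Main.v *)
(* For x on the unit sphere of a strictly convex space, a norming functional f
   at x satisfies |x| < |x + v| for 0 <> v in ker f: otherwise the midpoint of
   x and x + v would also have norm 1.  Hence x together with a Hamel basis of
   ker f made of unit vectors is strongly orthonormal relative to x.
   Conversely, for such a basis let c(v) be the coordinate of v along x: the
   operator v |-> c(v) x has norm 1, attained only on multiples of x.  Finally,
   if x = t y + (1 - t) z, an operator attaining its norm at x attains it at y
   and z too, so that y and z are unimodular multiples of x, and strict
   convexity of K gives y = z = x.

   Norming functionals come from a minimal sublinear functional q below the
   norm: comparing q with inf_(t >= 0) (q(x + t y) - t q(y)) shows that q is
   additive. *)
Require Import Defs.
From HB Require Import structures.
From mathcomp Require Import all_boot all_order all_algebra.
From mathcomp Require Import all_classical all_reals all_analysis.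
From mathcomp Require Import ring lra.

Set Implicit Arguments.
Unset Strict Implicit.
Unset Printing Implicit Defensive.

Import Order.TTheory GRing.Theory Num.Theory.
Import numFieldNormedType.Exports.

Local Open Scope classical_set_scope.
Local Open Scope ring_scope.

(** * Sublinear functionals and the Hahn-Banach theorem over the reals *)

Definition sublinear (R : realType) (V : lmodType R) (p : V -> R) : Prop :=
  (forall x y, p (x + y) <= p x + p y) /\
  (forall t x, 0 < t -> p (t *: x) <= t * p x).

Lemma sublinear0 (R : realType) (V : lmodType R) (p : V -> R) :
  sublinear p -> p 0 = 0.
Proof.
move=> [_ pZ]; have := pZ 2 0 (ltr0n _ 2); have := pZ 2^-1 0.
by rewrite !scaler0 invr_gt0 ltr0n => /(_ isT); lra.
Qed.

Lemma sublinearZ (R : realType) (V : lmodType R) (p : V -> R) t x :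
  sublinear p -> 0 <= t -> p (t *: x) = t * p x.
Proof.
move=> sp; rewrite le_eqVlt => /predU1P[<-|t0].
  by rewrite scale0r mul0r sublinear0.
apply/eqP; rewrite eq_le sp.2//=.
have := sp.2 t^-1 (t *: x); rewrite invr_gt0 => /(_ t0).
by rewrite scalerA mulVf ?gt_eqF// scale1r ler_pdivlMl.
Qed.

Lemma sublinear_geN (R : realType) (V : lmodType R) (p : V -> R) x :
  sublinear p -> - p (- x) <= p x.
Proof.
by move=> sp; have := sp.1 x (- x); rewrite subrr sublinear0// => ?; lra.
Qed.

(** For [f], [g] in [F] the witness [h] bounds the infimum at [x + y] by [f x + g y]; then infima
    are taken over [f] and [g] separately. This serves both chains and the families
    [directional p y]. *)
Lemma sublinear_inf (R : realType) (V : lmodType R) (F : set (V -> R)) :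
  F !=set0 -> (forall x, has_lbound [set f x | f in F]) ->
  (forall f g x y, F f -> F g -> exists2 h, F h & h (x + y) <= f x + g y) ->
  (forall f t x, F f -> 0 < t -> exists2 h, F h & h (t *: x) <= t * f x) ->
  sublinear (fun x => inf [set f x | f in F]).
Proof.
move=> [f0 Ff0] lbF addF scaleF.
have ne x : [set f x | f in F] !=set0 by exists (f0 x), f0.
split=> [x y|t x t0].
  rewrite -lerBlDr; apply: lb_le_inf => // _ [f Ff <-].
  rewrite lerBlDr -lerBlDl; apply: lb_le_inf => // _ [g Fg <-].
  rewrite lerBlDl; have [h Fh] := addF _ _ x y Ff Fg.
  by apply: le_trans; apply: ge_inf => //; exists h.
rewrite -ler_pdivrMl//; apply: lb_le_inf => // _ [f Ff <-].
rewrite ler_pdivrMl//; have [h Fh] := scaleF _ _ x Ff t0.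
by apply: le_trans; apply: ge_inf => //; exists h.
Qed.

Definition directional (R : realType) (V : lmodType R) (p : V -> R) (y : V) :
    set (V -> R) :=
  [set (fun x => p (x + t *: y) - t * p y) | t in [set t | 0 <= t]].

(** Subadditivity gives [t * p y = p (t *: y) <= p (x + t *: y) + p (- x)]. *)
Lemma directional_lbound (R : realType) (V : lmodType R) (p : V -> R) y x :
  sublinear p -> has_lbound [set f x | f in directional p y].
Proof.
move=> sp; exists (- p (- x)) => _ [_ [t t0 <-] <-].
have := sp.1 (x + t *: y) (- x).
by rewrite addrAC subrr add0r (sublinearZ _ sp t0); lra.
Qed.

Lemma sublinear_directional (R : realType) (V : lmodType R) (p : V -> R) y :
  sublinear p ->
  sublinear (fun x => inf [set f x | f in directional p y]).
Proof.
move=> sp; apply: sublinear_inf.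
- by exists (fun x => p (x + 0 *: y) - 0 * p y), 0 => /=.
- by move=> x; exact: directional_lbound.
- move=> _ _ x z [s s0 <-] [t t0 <-].
  exists (fun x => p (x + (s + t) *: y) - (s + t) * p y).
    by exists (s + t) => //=; rewrite addr_ge0.
  have := sp.1 (x + s *: y) (z + t *: y).
  by rewrite addrACA -scalerDl; lra.
- move=> _ t x [s s0 <-] t0.
  exists (fun x => p (x + (t * s) *: y) - (t * s) * p y).
    by exists (t * s) => //=; rewrite mulr_ge0// ltW.
  by rewrite -scalerA -scalerDr mulrBr -mulrA lerB// sp.2.
Qed.

Lemma directional_le (R : realType) (V : lmodType R) (p : V -> R) y x t :
  sublinear p -> 0 <= t ->
  inf [set f x | f in directional p y] <= p (x + t *: y) - t * p y.
Proof.
move=> sp t0; apply: ge_inf; first exact: directional_lbound.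
by exists (fun x => p (x + t *: y) - t * p y) => //; exists t.
Qed.

(** Zorn's lemma: along a chain the pointwise infimum is finite, since every member is at least
    [- p (- x)] at [x], and it is again sublinear. *)
Lemma minimal_sublinear (R : realType) (V : lmodType R) (p : V -> R) :
  sublinear p -> exists q : V -> R,
  [/\ sublinear q, forall x, q x <= p x
    & forall r, sublinear r -> (forall x, r x <= q x) -> r = q].
Proof.
move=> sp; pose T := {q : V -> R | sublinear q /\ forall x, q x <= p x}.
pose mk q (sq : sublinear q) (qp : forall x, q x <= p x) : T :=
  exist _ q (conj sq qp).
(* The order is reversed, so that a maximal element is a minimal functional. *)
pose le (q r : T) := `[< forall x, sval r x <= sval q x >].
have t0 : T by exists p.
have [||C Ctot|[q [sq qp]] qmin] := @ZL_preorder T t0 le.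
- by move=> q; apply/asboolP.
- move=> q r s /asboolP qr /asboolP rs; apply/asboolP => x.
  exact: le_trans (rs x) (qr x).
- have [[c0 Cc0]|C0] := pselect (C !=set0); last first.
    by exists t0 => s Cs; case: C0; exists s.
  pose F := [set sval c | c in C].
  have lbF x : has_lbound [set f x | f in F].
    exists (- p (- x)) => _ [_ [[c [sc cp]] Cc <-] <-] /=.
    by apply: le_trans (sublinear_geN _ sc); rewrite lerN2.
  have sF : sublinear (fun x => inf [set f x | f in F]).
    apply: sublinear_inf => //; first by exists (sval c0), c0.
    - move=> _ _ x y [c Cc <-] [d Cd <-].
      have [/asboolP cd|/asboolP dc] := Ctot _ _ Cc Cd.
        exists (sval d); first by exists d.
        by apply: le_trans ((svalP d).1.1 x y) _; rewrite lerD2r.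
      exists (sval c); first by exists c.
      by apply: le_trans ((svalP c).1.1 x y) _; rewrite lerD2l.
    - move=> _ t x [c Cc <-] tgt0; exists (sval c); first by exists c.
      exact: (svalP c).1.2.
  have Fle c x : C c -> inf [set f x | f in F] <= sval c x.
    by move=> Cc; apply: ge_inf => //; exists (sval c) => //; exists c.
  have Fp x : inf [set f x | f in F] <= p x.
    exact: le_trans (Fle _ _ Cc0) ((svalP c0).2 x).
  exists (mk _ sF Fp) => c Cc.
  by apply/asboolP => x /=; exact: Fle.
exists q; split=> // r sr rq.
have rp x : r x <= p x by exact: le_trans (rq x) (qp x).
have /asboolP qr : le (mk r sr rp) (mk q sq qp).
  by apply: qmin; apply/asboolP.
by apply/funext => x; apply/eqP; rewrite eq_le rq qr.
Qed.

Theorem hahn_banach (R : realType) (V : lmodType R) (p : V -> R) (x0 : V) :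
  sublinear p -> exists u : V -> R,
  [/\ forall x y, u (x + y) = u x + u y, forall t x, u (t *: x) = t * u x,
      forall x, u x <= p x & u x0 = p x0].
Proof.
move=> sp; pose p' x := inf [set f x | f in directional p x0].
have sp' : sublinear p' by exact: sublinear_directional.
(* Being below [p'] forces [q (- x0) <= - p x0], whence [q x0 = p x0]. *)
have [q [sq qp' qmin]] := minimal_sublinear sp'.
have qp x : q x <= p x.
  apply: (le_trans (qp' x)).
  apply: le_trans (directional_le _ _ _ (lexx 0)) _ => //.
  by rewrite scale0r addr0 mul0r subr0.
have qD x y : q (x + y) = q x + q y.
  apply/eqP; rewrite eq_le sq.1/=.
  (* Minimality makes [q] equal to its own directional infimum along [y]; the term [t = 1] then
     bounds [q x] by [q (x + y) - q y]. *)
  have <- : inf [set f x | f in directional q y] = q x.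
    have qyq := qmin _ (sublinear_directional y sq).
    rewrite -[RHS](congr1 (@^~ x) (qyq _)) // => z.
    apply: le_trans (directional_le _ _ sq (lexx 0)) _.
    by rewrite scale0r addr0 mul0r subr0.
  rewrite -lerBrDr; apply: le_trans (directional_le _ _ _ ler01) _ => //.
  by rewrite scale1r mul1r.
have qN x : q (- x) = - q x.
  by apply/eqP; rewrite -addr_eq0 -qD addNr sublinear0.
exists q; split=> //.
  move=> t x; have [t0|t0] := leP 0 t; first exact: sublinearZ.
  have Nt0 : 0 <= - t by rewrite oppr_ge0 ltW.
  by rewrite -[t]opprK scaleNr qN (sublinearZ _ sq Nt0) -mulNr.
apply/eqP; rewrite eq_le qp/= -lerN2 -qN.
apply: (le_trans (qp' _)); apply: le_trans (directional_le _ _ _ ler01) _ => //.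
by rewrite scale1r addNr sublinear0// mul1r sub0r.
Qed.

(** * Three properties of the scalars, and their proofs over the reals *)

Definition norming_functionals (K : numFieldType) : Prop :=
  forall (X : normedModType K) (x : X), `|x| = 1 ->
  exists f : {scalar X}, f x = 1 /\ forall y, `|f y| <= `|y|.

(** Extremality of 1 in the unit disc, tested on unimodular scalars only: the endpoints of a segment
    through [x] will turn out to be unimodular multiples of [x]. *)
Definition rotund_scalars (K : numFieldType) : Prop :=
  forall t a b : K, 0 < t -> t < 1 -> `|a| = 1 -> `|b| = 1 ->
  t * a + (1 - t) * b = 1 -> a = 1 /\ b = 1.

Definition nonneg_sups (K : numFieldType) : Prop :=
  forall A : set K, A !=set0 -> (forall a, A a -> 0 <= a) ->
  has_ubound A -> supremums A !=set0.

Lemma sublinear_norm (R : realType) (X : normedModType R) :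
  sublinear (fun x : X => `|x|).
Proof.
split=> [x y|t x t0]; first exact: ler_normD.
by rewrite normrZ gtr0_norm.
Qed.

Lemma real_norming_functionals (R : realType) : norming_functionals R.
Proof.
move=> X x x1; have [u [uD uZ ule ux]] := hahn_banach x (sublinear_norm X).
have ulin : scalar u by move=> a y z; rewrite uD uZ.
pose f : {scalar X} := HB.pack u (GRing.isLinear.Build R X R *%R u ulin).
exists f; split=> [|y]; first by rewrite /f/= ux.
rewrite ler_norml ule andbT lerNl -[X in _ <= X]normrN.
by rewrite (le_trans _ (ule _))// -[in leRHS]scaleN1r uZ mulN1r.
Qed.

Lemma real_rotund_scalars (R : realType) : rotund_scalars R.
Proof.
move=> t a b t0 t1 a1 b1 E.
have := ler_norm a; have := ler_norm b; rewrite a1 b1 => ? ?.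
by split; nra.
Qed.

Lemma real_nonneg_sups (R : realType) : nonneg_sups R.
Proof.
move=> A A0 _ ubA; exists (sup A); split; first exact: ub_le_sup.
by move=> b bA; exact: ge_sup.
Qed.

(** * Complex scalars, treated through the underlying real space *)

Definition realification (R : realType) (X : lmodType R[i]) : Type := X.

Section realification.
Variables (R : realType) (X : lmodType R[i]).

HB.instance Definition _ := GRing.Zmodule.on (realification X).

Let rscale (t : R) (x : realification X) : realification X :=
  (t%:C)%C *: (x : X).

Let rscaleA a b v : rscale a (rscale b v) = rscale (a * b) v.
Proof. by rewrite /rscale scalerA rmorphM. Qed.

Let rscale1 : left_id 1 rscale.
Proof. by move=> v; rewrite /rscale rmorph1 scale1r. Qed.

Let rscaleDr : right_distributive rscale +%R.
Proof. by move=> a u v; rewrite /rscale scalerDr. Qed.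

Let rscaleDl v : {morph rscale^~ v : a b / a + b}.
Proof. by move=> a b; rewrite /rscale rmorphD scalerDl. Qed.

HB.instance Definition _ :=
  GRing.Zmodule_isLmodule.Build R (realification X)
    rscaleA rscale1 rscaleDr rscaleDl.

Lemma realification_scaleE (t : R) (x : realification X) :
  t *: x = (t%:C)%C *: (x : X).
Proof. by []. Qed.

End realification.

Lemma nonneg_ReE (R : realType) (a : R[i]) :
  0 <= a -> a = ((complex.Re a)%:C)%C.
Proof. by move=> a0; rewrite RRe_real// ger0_real. Qed.

Lemma sublinear_Re_norm (R : realType) (X : normedModType R[i]) :
  sublinear (fun x : realification X => complex.Re `|x : X|).
Proof.
split=> [x y|t x t0].
  rewrite -lecR rmorphD/= -!nonneg_ReE//; exact: ler_normD.
rewrite -lecR rmorphM/= -!nonneg_ReE// realification_scaleE normrZ.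
by rewrite ger0_norm// ler0c ltW.
Qed.

Lemma complex_norming_functionals (R : realType) : norming_functionals R[i].
Proof.
move=> X x x1.
have [u [uD uZ ule ux]] :=
  hahn_banach (x : realification X) (sublinear_Re_norm X).
(* The complex-linear functional with real part [u]. *)
pose g (y : X) : R[i] := (u y +i* - u ('i%C *: y : X))%C.
have glin : scalar g.
  move=> [a b] y z; rewrite /g.
  (* Real linearity expresses [u] at [(a + ib) v] and at [i (a + ib) v] through [u v] and [u (i v)];
     complex linearity of [g] is then a ring identity in each component. *)
  have ucomb (c d : R) (v w : X) :
      u ((c%:C)%C *: v + (d%:C)%C *: w) = c * u v + d * u w.
    exact: etrans (uD _ _) (congr2 _ (uZ _ _) (uZ _ _)).
  have uE v : u ((a +i* b)%C *: v) = a * u v + b * u ('i%C *: v).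
    rewrite -ucomb scalerA -scalerDl; congr (u _).
    apply: (congr1 (fun c => c *: v)).
    by apply/eqP; rewrite eq_complex/=; apply/andP; split; apply/eqP; ring.
  have uiE v : u ('i%C *: ((a +i* b)%C *: v)) = - b * u v + a * u ('i%C *: v).
    rewrite -ucomb !scalerA -scalerDl; congr (u _).
    apply: (congr1 (fun c => c *: v)).
    by apply/eqP; rewrite eq_complex/=; apply/andP; split; apply/eqP; ring.
  rewrite scalerDr [u (_ + _)]uD uE [u (_ + _)]uD uiE.
  by apply/eqP; rewrite eq_complex/=; apply/andP; split; apply/eqP; ring.
pose f : {scalar X} := HB.pack g (GRing.isLinear.Build R[i] X R[i] *%R g glin).
have fle y : `|f y| <= `|y|.
  have [->|fy0] := eqVneq (f y) 0; first by rewrite normr0.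
  (* A unimodular [c] rotates [f y] to the nonnegative real [|f y|], which is then the value of [u]
     at [c *: y]. *)
  pose c := (f y)^* / `|f y|.
  have c1 : `|c| = 1.
    by rewrite normrM norm_conjC normfV normr_id divff// normr_eq0.
  have fcy : f (c *: y) = `|f y|.
    rewrite linearZ/= /c mulrAC -normCKC expr2 -mulrA divff ?mulr1//.
    by rewrite normr_eq0.
  have ufcy : u (c *: y) = complex.Re `|f y| by rewrite -fcy.
  rewrite [X in X <= _]nonneg_ReE// -ufcy [X in _ <= X]nonneg_ReE// lecR.
  by apply: le_trans (ule _) _; rewrite normrZ c1 mul1r.
exists f; split=> //.
have := fle x; rewrite x1 => fx1.
have ux1 : u x = 1 by rewrite ux x1.
(* The real part of [f x] is already 1 and its modulus is at most 1, so the imaginary part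
   vanishes. *)
have : ((complex.Re (f x) ^+ 2 + complex.Im (f x) ^+ 2)%:C <= 1%:C)%C.
  by rewrite add_Re2_Im2 expr_le1.
rewrite lecR /f/= ux1 expr1n sqrrN gerDl => h.
have ui0 : u ('i%C *: x : X) = 0.
  by apply/eqP; rewrite -sqrf_eq0 eq_le h sqr_ge0.
by rewrite /g ux1 ui0 oppr0.
Qed.

(** Equality case of the triangle inequality: the terms [t * a] and [(1 - t) * b] have moduli [t]
    and [1 - t], and their sum equals the sum of these moduli, so each term equals its modulus. *)
Lemma complex_rotund_scalars (R : realType) : rotund_scalars R[i].
Proof.
move=> t a b t0 t1 a1 b1 E.
have s0 : 0 < 1 - t by rewrite subr_gt0.
pose F (c : bool) := if c then t * a else (1 - t) * b.
pose G (c : bool) : R[i] := if c then t else 1 - t.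
have FG c : true -> `|F c| <= G c.
  by case: c => _; rewrite /= normrM ?a1 ?b1 mulr1 gtr0_norm.
have sFG : \sum_(c | true) F c = \sum_(c | true) G c.
  by rewrite !big_bool/= E addrC subrK.
split.
  have /= := normC_sum_upper FG sFG (i := true) isT.
  by rewrite -[RHS]mulr1; apply: mulfI; rewrite gt_eqF.
have /= := normC_sum_upper FG sFG (i := false) isT.
by rewrite -[RHS]mulr1; apply: mulfI; rewrite gt_eqF.
Qed.

(** An upper bound of a nonempty set of nonnegative numbers is itself nonnegative, hence real, so
    the supremum of the real parts is the least one. *)
Lemma complex_nonneg_sups (R : realType) : nonneg_sups R[i].
Proof.
move=> A [a0 Aa0] Age0 [M ubM].
have ReA a : A a -> a = ((complex.Re a)%:C)%C by move=> /Age0/nonneg_ReE.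
have ubRe b : ubound A b ->
    b = ((complex.Re b)%:C)%C /\
    ubound [set complex.Re a | a in A] (complex.Re b).
  move=> ubb; have bE : b = ((complex.Re b)%:C)%C.
    by apply: nonneg_ReE; exact: le_trans (Age0 _ Aa0) (ubb _ Aa0).
  split=> // _ [a Aa <-].
  by rewrite -lecR -bE -ReA//; exact: ubb.
have ne : [set complex.Re a | a in A] !=set0 by exists (complex.Re a0), a0.
exists ((sup [set complex.Re a | a in A])%:C)%C; split.
  move=> a Aa; rewrite [a]ReA// lecR; apply: ub_le_sup; last by exists a.
  by exists (complex.Re M); exact: (ubRe _ ubM).2.
move=> b /ubRe[-> ubb]; rewrite lecR.
exact: ge_sup.
Qed.

(** * Linear spans, linear independence and finite subfamilies *)

Section linear_span.
Variables (K : numFieldType) (X : normedModType K).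
Implicit Types (B D F : set X) (l : X -> K) (M : set X) (v w x y : X).

(** Same body as in [spanning], so that [spanning B] unfolds to [in_span B v] for all [v]. *)
Definition in_span B v : Prop := exists (F : set X) (l : X -> K),
  [/\ finite_set F, F `<=` B & v = \sum_(y \in F) l y *: y].

(** Reduces a claim about a span to its generators; applied below to the kernel of a functional and
    to the set of vectors having a coordinate along [x]. *)
Lemma in_span_min M B v :
  M 0 -> (forall v w, M v -> M w -> M (v + w)) ->
  (forall a v, M v -> M (a *: v)) -> B `<=` M -> in_span B v -> M v.
Proof.
move=> M0 MD MZ BM [F [l [_ FB ->]]]; rewrite big_seq; apply: big_ind => // y.
by case: finite_supportP => // Y YF _ _ /YF/FB/BM; exact: MZ.
Qed.

Lemma in_span0 B : in_span B 0.
Proof. by exists set0, (fun=> 0); split=> //; rewrite fsbig_set0. Qed.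

Lemma mem_in_span B v : B v -> in_span B v.
Proof.
move=> Bv; exists [set v], (fun=> 1); split=> //; first by move=> _ ->.
by rewrite fsbig_set1 scale1r.
Qed.

Lemma scaler_fsumr a F l : finite_set F ->
  a *: (\sum_(y \in F) l y *: y) = \sum_(y \in F) (a * l y) *: y.
Proof.
move=> finF; rewrite !fsbig_finite// scaler_sumr.
by apply: eq_bigr => y _; rewrite scalerA.
Qed.

Lemma in_spanZ B a v : in_span B v -> in_span B (a *: v).
Proof.
move=> [F [l [finF FB ->]]]; exists F, (fun y => a * l y); split=> //.
exact: scaler_fsumr.
Qed.

(** Extending coefficients by zero brings sums over different finite sets to a common index set. *)
Lemma fsum_scale_widen F D l : F `<=` D ->
  \sum_(y \in F) l y *: y = \sum_(y \in D) (if y \in F then l y else 0) *: y.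
Proof.
move=> FD; rewrite -(fsbig_widen F D) => [|//|y [_ Fy]]; last first.
  by rewrite /= memNset// scale0r.
by apply: eq_fsbigr => y ->.
Qed.

Lemma in_spanD B v w : in_span B v -> in_span B w -> in_span B (v + w).
Proof.
move=> [F [l [finF FB ->]]] [G [k [finG GB ->]]].
exists (F `|` G),
  (fun y => (if y \in F then l y else 0) + (if y \in G then k y else 0)).
split; [by rewrite finite_setU | by move=> y [/FB|/GB] |].
rewrite (@fsum_scale_widen F (F `|` G)); last exact: subsetUl.
rewrite (@fsum_scale_widen G (F `|` G)); last exact: subsetUr.
rewrite -fsbig_split/=; last by rewrite finite_setU.
by apply: eq_fsbigr => y _; rewrite scalerDl.
Qed.

Lemma linearly_independent_setU1 B w :
  linearly_independent B -> ~ in_span B w -> linearly_independent (w |` B).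
Proof.
move=> liB wB F l finF FwB sum0.
have FB : F `\ w `<=` B by move=> y [/FwB[]].
have finFw : finite_set (F `\ w) by exact: finite_setD.
have sumE : F w -> l w *: w + \sum_(y \in F `\ w) l y *: y = 0.
  by move=> Fw; rewrite -(fsbigD1 w F (fun y => l y *: y)).
have lw0 : F w -> l w = 0.
  (* If the coefficient of [w] were nonzero, the relation could be solved for [w], placing it in the
     span of [B]. *)
  move=> Fw; apply: contrapT => /eqP lw0; apply: wB.
  exists (F `\ w), (fun y => - (l w)^-1 * l y); split=> //.
  rewrite -scaler_fsumr// scaleNr -scalerN.
  move/eqP: (sumE Fw); rewrite addr_eq0 => /eqP <-.
  by rewrite scalerA mulVf ?scale1r.
have sumFw : \sum_(y \in F `\ w) l y *: y = 0.
  have [Fw|Fw] := pselect (F w).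
    by have := sumE Fw; rewrite lw0// scale0r add0r.
  by rewrite not_setD1.
move=> y Fy; have [yw|yw] := pselect (y = w); first by rewrite yw lw0// -yw.
exact: (liB _ _ finFw FB sumFw).
Qed.

(** Induction on the elements of [F]: of the member found so far and one containing the new element,
    the larger works. *)
Lemma finite_sub_chain (T : choiceType) (C : set (set T)) (F : set T) :
  C !=set0 -> total_on C subset -> finite_set F -> F `<=` \bigcup_(B in C) B ->
  exists2 B, C B & F `<=` B.
Proof.
move=> [B0 CB0] Ctot /finite_seqP[s ->]; elim: s => [|y s IHs] sC.
  by exists B0.
have [|B CB sB] := IHs.
  by move=> z zs; apply: sC; rewrite /= inE zs orbT.
have [|D CD Dy] := sC y; first by rewrite /= mem_head.
have [BD|DB] := Ctot _ _ CB CD.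
  by exists D => // z /=; rewrite inE => /predU1P[->|/sB/BD].
by exists B => // z /=; rewrite inE => /predU1P[->|/sB]//; exact: DB.
Qed.

Lemma linearly_independent_chain (C : set (set X)) :
  C `<=` @linearly_independent K X -> total_on C subset ->
  linearly_independent (\bigcup_(B in C) B).
Proof.
move=> liC Ctot F l finF FC sum0 y Fy.
have [|B CB FB] := @finite_sub_chain _ C F _ Ctot finF FC.
  by have [B CB _] := FC _ Fy; exists B.
exact: (liC _ CB _ _ finF FB sum0).
Qed.

(** Removes the case distinction of the definition: when [B] is finite, coefficients on [F] are
    extended by zero to [B]. *)
Lemma strongly_orthogonal_finite B x F :
  strongly_orthogonal B x -> finite_set F -> F `<=` B -> F x ->
  finite_strongly_orthogonal F x.
Proof.
move=> [_ finso infso] finF FB Fx.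
have [finB|infB] := pselect (finite_set B); last exact: infso.
move=> l [y Fy ly0]; have FxBx : F `\ x `<=` B `\ x by exact: setSD.
rewrite (fsum_scale_widen _ FxBx); apply: finso => //.
by exists y; [exact: FxBx | rewrite mem_set].
Qed.

End linear_span.

(** * The three implications over a general scalar field *)

Section characterizations.
Variables (K : numFieldType) (X : normedModType K).

Lemma strictly_convex_orthogonal_kernel (f : {scalar X}) (x v : X) :
  strictly_convex X -> f x = 1 -> (forall y, `|f y| <= `|y|) ->
  `|x| = 1 -> f v = 0 -> v != 0 -> 1 < `|x + v|.
Proof.
move=> scX fx fle x1 fv v0.
(* The line through [x] in the direction [v] stays in [f = 1], hence outside the open unit ball;
   used for [x + v] and for the midpoint. *)
have fxv c : 1 <= `|x + c *: v|.
  by rewrite (le_trans _ (fle _))// linearD linearZ/= fv mulr0 addr0 fx normr1.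
have := fxv 1; rewrite scale1r le_eqVlt => /predU1P[xv1|//].
have h0 : (0 : K) < 2^-1 by rewrite invr_gt0.
have h1 : (2^-1 : K) < 1 by rewrite invf_lt1// ltr1n.
have hh : (1 : K) - 2^-1 = 2^-1 by field.
pose z := x + 2^-1 *: v.
have zE : z = 2^-1 *: x + (1 - 2^-1) *: (x + v).
  by rewrite hh scalerDr addrA -scalerDl -{2}hh [2^-1 + _]addrC subrK scale1r.
have z1 : `|z| = 1.
  apply/eqP; rewrite eq_le fxv andbT zE (le_trans (ler_normD _ _))// !normrZ.
  by rewrite -xv1 x1 !mulr1 hh gtr0_norm// -{2}hh addrC subrK.
have [||xz _] := (scX _ z1).2 x (x + v) 2^-1 _ _ h0 h1 zE.
- by rewrite /unit_ball/= x1.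
- by rewrite /unit_ball/= -xv1.
move: xz; rewrite /z => /eqP.
by rewrite eq_sym -subr_eq0 addrAC subrr add0r scaler_eq0 gt_eqF//= (negPf v0).
Qed.

Lemma strictly_convex_strongly_orthonormal_basis (x : X) :
  norming_functionals K -> strictly_convex X -> `|x| = 1 ->
  exists B : set X, [/\ hamel_basis B, B x & strongly_orthonormal B x].
Proof.
move=> nfK scX x1; have [f [fx fle]] := nfK X x x1.
(* A maximal independent set of unit vectors in the kernel of [f] is a Hamel basis of that
   kernel. *)
have [|B [[liB uB fB] maxB]] := @Zorn_bigcup X [set B |
    [/\ linearly_independent B, B `<=` unit_sphere X
      & forall y, B y -> f y = 0]].
  move=> C CP Ctot; split.
  - by apply: linearly_independent_chain => // B /CP[].
  - by move=> y [B /CP[_ uB _]]; exact: uB.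
  - by move=> y [B /CP[_ _ fB]]; exact: fB.
have fspan v : in_span B v -> f v = 0.
  apply: (in_span_min (M := fun v => f v = 0)) => [|y w fy fw|a y fy|//].
  - exact: linear0.
  - by rewrite linearD fy fw addr0.
  - by rewrite linearZ/= fy mulr0.
have kerB v : f v = 0 -> in_span B v.
  move=> fv; have [->|v0] := eqVneq v 0; first exact: in_span0.
  have nv0 : `|v| != 0 by rewrite normr_eq0.
  (* Members of the family are unit vectors, so [v] is normalized before being adjoined to [B]
     against maximality. *)
  rewrite -[v]scale1r -(divff nv0) -scalerA; apply: in_spanZ.
  set w := `|v|^-1 *: v; have fw : f w = 0 by rewrite linearZ/= fv mulr0.
  apply: contrapT => wB; apply: (maxB (w |` B)).
    split; first exact: subsetUr.
    by move=> wBB; apply/wB/mem_in_span/wBB; left.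
  split; first exact: linearly_independent_setU1.
  - move=> y [->|/uB//].
    by rewrite /unit_sphere/= normrZ normfV normr_id mulVf.
  - by move=> y [->|/fB].
have xB : ~ in_span B x.
  by move=> /fspan; rewrite fx => /eqP; rewrite oner_eq0.
have lixB : linearly_independent (x |` B) by exact: linearly_independent_setU1.
have orth F : finite_set F -> F `<=` x |` B -> F x ->
    finite_strongly_orthogonal F x.
  move=> finF FB Fx l [y Fy ly0]; rewrite x1.
  have FxB : F `\ x `<=` B by move=> z [/FB[]].
  apply: strictly_convex_orthogonal_kernel fx _ _ _ _ => //.
    by apply: fspan; exists (F `\ x), l; split=> //; exact: finite_setD.
  (* Independence of [B] turns a nonzero coefficient into a nonzero vector. *)
  apply: contraNN ly0 => /eqP sum0; apply/eqP.
  exact: (liB _ _ (finite_setD _ finF) FxB sum0).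
exists (x |` B); split; [split=> // v|by left|split].
- suff : in_span (x |` B) (f v *: x + (v - f v *: x)) by rewrite addrC subrK.
  apply: in_spanD; first by apply/in_spanZ/mem_in_span; left.
  have /kerB : f (v - f v *: x) = 0 by rewrite linearB linearZ/= fx mulr1 subrr.
  by move=> [F [l [finF FB ->]]]; exists F, l; split=> // y /FB; right.
- by split=> [|finB|_ F]; [left | apply: orth => //; left | exact: orth].
- by move=> y [->//|/uB].
Qed.

(** Passes from coefficients to vectors: a nonzero [m] has a nonzero coefficient. Adjoining [x] to
    [F] gives a finite subset to which the definition applies. *)
Lemma in_span_orthogonal (B : set X) (x m : X) :
  strongly_orthogonal B x -> in_span (B `\ x) m -> m != 0 -> `|x| < `|x + m|.
Proof.
move=> sB [F [l [finF FB ->]]] m0.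
have FxE : (x |` F) `\ x = F.
  rewrite setDUl setDv set0U not_setD1// => /FB[_]; exact.
have : finite_strongly_orthogonal (x |` F) x.
  apply: (strongly_orthogonal_finite sB); [|move=> y [->|/FB[]//]|by left].
    by rewrite finite_setU.
  by case: sB.
rewrite /finite_strongly_orthogonal FxE; apply.
apply: contrapT => l0; move/eqP: m0; apply.
apply: fsbig1 => y Fy; apply/eqP; rewrite scaler_eq0; apply/orP; left.
by apply: contrapT => /negP ly0; apply: l0; exists y.
Qed.

Lemma supremum_max (A : set K) (m : K) : A m -> ubound A m -> supremum 0 A = m.
Proof.
move=> Am ubA; have supm : supremums A m by split=> // b; exact.
rewrite /supremum ifF; last by apply/negbTE/set0P; exists m.
by apply: (is_subset1_supremums _ supm); exact: (xgetPex 0 (ex_intro _ m supm)).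
Qed.

Lemma bounded_operatorP (A : {linear X -> X}) :
  bounded_operator A <-> exists M, forall y, `|y| <= 1 -> `|A y| <= M.
Proof.
have ball0 : unit_ball X 0 by rewrite /unit_ball/= normr0 ler01.
exact: (@ex_bound _ _ _ A _ (globally_properfilter ball0)).
Qed.

Lemma basis_norm_attaining_operator (B : set X) (x : X) :
  hamel_basis B -> B x -> strongly_orthonormal B x ->
  exists A : {linear X -> X}, bounded_operator A /\ attains_norm_only_at A x.
Proof.
move=> [_ spanB] Bx [soB uB]; have x1 : `|x| = 1 by exact: uB.
pose M := in_span (B `\ x).
have orthM m : M m -> m != 0 -> 1 < `|x + m|.
  by rewrite -x1; exact: in_span_orthogonal.
(* Otherwise orthogonality applied to [- x] would give [1 < 0]. *)
have xM : ~ M x.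
  move=> Mx; have MNx : M (- x) by rewrite -scaleN1r; exact: in_spanZ.
  have := orthM _ MNx; rewrite subrr normr0 ltr10 oppr_eq0.
  by rewrite -normr_eq0 x1 oner_eq0 => /(_ isT).
have /choice[c cM] v : exists c : K, M (v - c *: x).
  apply: (in_span_min (M := fun v => exists c, M (v - c *: x))
    _ _ _ _ (spanB v)).
  - by exists 0; rewrite scale0r subrr; exact: in_span0.
  - move=> y z [a ya] [b zb]; exists (a + b).
    by rewrite scalerDl opprD addrACA; exact: in_spanD.
  - move=> a y [b yb]; exists (a * b).
    by rewrite -scalerA -scalerBr; exact: in_spanZ.
  - move=> y By; have [->|/eqP yx] := eqVneq y x.
      by exists 1; rewrite scale1r subrr; exact: in_span0.
    by exists 0; rewrite scale0r subr0; exact: mem_in_span.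
(* Two decompositions of [v] differ by a multiple of [x] lying in [M], and [x] is not in [M].
   Linearity of [c] follows by exhibiting decompositions. *)
have c_uniq v a : M (v - a *: x) -> c v = a.
  move=> Ma; apply: contrapT => /eqP; rewrite -subr_eq0 => ca; apply: xM.
  rewrite -[x]scale1r -(mulVf ca) -scalerA; apply: in_spanZ.
  rewrite (_ : _ *: x = (v - a *: x) - (v - c v *: x)).
    by apply: in_spanD => //; rewrite -[- (_ - _)]scaleN1r; exact/in_spanZ/cM.
  by rewrite opprB [RHS]addrC addrA subrK scalerBl.
have c_lin : linear (fun v => c v *: x).
  move=> a v w; rewrite scalerA -scalerDl; congr (_ *: _); apply: c_uniq.
  rewrite scalerDl opprD addrACA -scalerA -scalerBr.
  by apply: in_spanD; [exact/in_spanZ/cM | exact: cM].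
pose A : {linear X -> X} :=
  HB.pack (fun v => c v *: x) (GRing.isLinear.Build K X X *:%R _ c_lin).
have AE v : A v = c v *: x by [].
have nA v : `|A v| = `|c v| by rewrite AE normrZ x1 mulr1.
(* Factoring out [c v] leaves [x] plus an element of [M], whose norm exceeds 1 unless that element
   is 0. *)
have vE v : c v != 0 -> `|v| = `|c v| * `|x + (c v)^-1 *: (v - c v *: x)|.
  by move=> c0; rewrite -normrZ scalerDr scalerA divff// scale1r addrC subrK.
have nA_lt v : c v != 0 -> v - c v *: x != 0 -> `|A v| < `|v|.
  move=> c0 m0; rewrite nA (vE _ c0) ltr_pMr ?normr_gt0//.
  by apply: orthM; [exact/in_spanZ/cM | rewrite scaler_eq0 invr_eq0 negb_or c0].
have nA_le v : `|A v| <= `|v|.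
  have [c0|c0] := eqVneq (c v) 0; first by rewrite nA c0 normr0.
  have [m0|m0] := eqVneq (v - c v *: x) 0; last exact/ltW/nA_lt.
  by rewrite nA (vE _ c0) m0 scaler0 addr0 x1 mulr1.
have cx a : c (a *: x) = a by apply: c_uniq; rewrite subrr; exact: in_span0.
have normA : operator_norm A = 1.
  apply: supremum_max.
    exists x; first by rewrite /unit_ball/= x1.
    by rewrite nA -[x]scale1r cx normr1.
  by move=> _ [y y1 <-]; exact: le_trans (nA_le y) y1.
exists A; split.
  apply/bounded_operatorP; exists 1 => y y1; exact: le_trans (nA_le y) y1.
rewrite /attains_norm_only_at normA; apply/seteqP.
split=> [y [y1 Ay1]|_ [a a1 <-]].
  have c1 : `|c y| = 1 by rewrite -nA.
  exists (c y) => //; apply/eqP; rewrite eq_sym -subr_eq0.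
  apply: contraT => m0; have := nA_lt y _ m0.
  by rewrite Ay1 y1 ltxx -normr_eq0 c1 oner_eq0 => /(_ isT).
by rewrite /unit_sphere/= nA cx normrZ a1 x1 mulr1.
Qed.

(** The nonnegative numbers [t * (c - a)] and [(1 - t) * (c - b)] have a nonpositive sum, so both
    vanish. *)
Lemma convex_comb_max (t a b c : K) : 0 < t -> t < 1 -> a <= c -> b <= c ->
  c <= t * a + (1 - t) * b -> a = c /\ b = c.
Proof.
move=> t0 t1 ac bc h; have s0 : 0 < 1 - t by rewrite subr_gt0.
have ca : 0 <= t * (c - a) by rewrite mulr_ge0 ?subr_ge0// ltW.
have cb : 0 <= (1 - t) * (c - b) by rewrite mulr_ge0 ?subr_ge0// ltW.
have sum0 : t * (c - a) + (1 - t) * (c - b) = 0.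
  apply/eqP; rewrite eq_le addr_ge0// andbT.
  have -> : t * (c - a) + (1 - t) * (c - b) = c - (t * a + (1 - t) * b) by ring.
  by rewrite subr_le0.
move/eqP: sum0; rewrite paddr_eq0// !mulf_eq0.
rewrite (gt_eqF t0) (gt_eqF s0)/= !subr_eq0.
by move=> /andP[/eqP -> /eqP ->].
Qed.

(** [supremum] is a choice with a default value; [nonneg_sups] provides a least upper bound, so the
    chosen value is one. *)
Lemma operator_norm_ub (A : {linear X -> X}) (y : X) :
  nonneg_sups K -> bounded_operator A -> `|y| <= 1 -> `|A y| <= operator_norm A.
Proof.
move=> supK /bounded_operatorP[M AM] y1; rewrite /operator_norm /supremum.
set S := [set _ | _ in _]; have Sy : S `|A y| by exists y.
rewrite ifF; last by apply/negbTE/set0P; exists `|A y|.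
have [|||s sS] := supK S.
- by exists `|A y|.
- by move=> _ [z _ <-].
- by exists M => _ [z z1 <-]; exact: AM.
by have [ubS _] := xgetPex 0 (ex_intro _ s sS); exact: ubS.
Qed.

Lemma norm_attaining_extreme (A : {linear X -> X}) (x : X) :
  nonneg_sups K -> rotund_scalars K -> `|x| = 1 ->
  bounded_operator A -> attains_norm_only_at A x ->
  extreme_point (unit_ball X) x.
Proof.
move=> supK rotK x1 bA attA; split; first by rewrite /unit_ball/= x1.
move=> y z t y1 z1 t0 t1 xE; have s0 : 0 < 1 - t by rewrite subr_gt0.
(* Used with the identity to get [|y| = |z| = 1], then with [A] to see that the norm is attained at
   [y] and [z]. *)
have comb (g : {linear X -> X}) : `|g x| <= t * `|g y| + (1 - t) * `|g z|.
  rewrite xE linearD !linearZ/= (le_trans (ler_normD _ _))// !normrZ.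
  by rewrite !gtr0_norm.
have [ny nz] : `|y| = 1 /\ `|z| = 1.
  by apply: (convex_comb_max t0) => //; have := comb idfun; rewrite /= x1.
have Ax : `|A x| = operator_norm A.
  have : [set l *: x | l in [set l : K | `|l| = 1]] x.
    by exists 1; rewrite /= ?normr1 ?scale1r.
  by rewrite -attA => -[].
have [Ay Az] : `|A y| = operator_norm A /\ `|A z| = operator_norm A.
  apply: (convex_comb_max t0) => //; [exact: operator_norm_ub..|].
  by rewrite -{1}Ax.
have mult w : `|w| = 1 -> `|A w| = operator_norm A ->
    exists2 l : K, `|l| = 1 & l *: x = w.
  move=> w1 Aw.
  by have : [set l *: x | l in [set l : K | `|l| = 1]] w by rewrite -attA.
have [l l1 lE] := mult y ny Ay; have [k k1 kE] := mult z nz Az.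
(* Comparing coefficients of the nonzero vector [x] reduces the claim to the scalars. *)
have lk1 : t * l + (1 - t) * k = 1.
  apply/eqP; rewrite -subr_eq0.
  have : (t * l + (1 - t) * k - 1) *: x == 0.
    by rewrite scalerBl scalerDl -!scalerA lE kE -xE scale1r subrr.
  by rewrite scaler_eq0 -[x == 0]normr_eq0 x1 oner_eq0 orbF.
have [l_1 k_1] := rotK t l k t0 t1 l1 k1 lk1.
by rewrite -lE -kE l_1 k_1 scale1r.
Qed.

(** Norming functionals enter in passing from strict convexity to bases, suprema and rotundity of
    the scalars in returning from operators to strict convexity. *)
Theorem strict_convexity_tfae :
  norming_functionals K -> nonneg_sups K -> rotund_scalars K ->
  [<-> strictly_convex X;
       forall x : X, unit_sphere X x -> exists B : set X,
         [/\ hamel_basis B, B x & strongly_orthonormal B x];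
       forall x : X, unit_sphere X x -> exists A : {linear X -> X},
         bounded_operator A /\ attains_norm_only_at A x].
Proof.
move=> nfK supK rotK; tfae.
- by move=> scX x; exact: strictly_convex_strongly_orthonormal_basis.
- move=> basis x /basis[B [hB Bx soB]].
  exact: basis_norm_attaining_operator hB Bx soB.
- move=> oper x x1; have [A [bA attA]] := oper x x1.
  exact: norm_attaining_extreme bA attA.
Qed.

End characterizations.

Theorem theorem2p7 (R : realType) :
  (forall X : normedModType R,
    [<-> strictly_convex X;
         forall x : X, unit_sphere X x -> exists B : set X,
           [/\ hamel_basis B, B x & strongly_orthonormal B x];
         forall x : X, unit_sphere X x -> exists A : {linear X -> X},
           bounded_operator A /\ attains_norm_only_at A x]) /\
  (forall X : normedModType (complex R),
    [<-> strictly_convex X;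
         forall x : X, unit_sphere X x -> exists B : set X,
           [/\ hamel_basis B, B x & strongly_orthonormal B x];
         forall x : X, unit_sphere X x -> exists A : {linear X -> X},
           bounded_operator A /\ attains_norm_only_at A x]).
Proof.
split=> X; apply: strict_convexity_tfae.
- exact: real_norming_functionals.
- exact: real_nonneg_sups.
- exact: real_rotund_scalars.
- exact: complex_norming_functionals.
- exact: complex_nonneg_sups.
- exact: complex_rotund_scalars.
Qed.
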